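(* Let $A\in\mathbb{C}^{m\times n}$, $W\in\mathbb{C}^{n\times m}$ with $\mathrm{ind}(WA)=k$. Then (1) $A^{\mathrm{cEP},W}=A^{D,W}P_{(WA)^k}$; (2) $A^{D,W}=A^{\mathrm{cEP},W}P_{\mathcal{R}((WA)^k),\mathcal{N}((WA)^k)}$.
   Context: For a square complex matrix $B$, $\mathrm{ind}(B)$ is the smallest non-negative integer $j$ with $\mathrm{rank}(B^j)=\mathrm{rank}(B^{j+1})$ (with $B^0=I$). $B^{\dagger}$, $\mathcal{R}(B)$ and $\mathcal{N}(B)$ denote the Moore-Penrose inverse, range (column space) and null space of $B$. For $A\in\mathbb{C}^{m\times n}$, $W\in\mathbb{C}^{n\times m}$ and $p=\max\{\mathrm{ind}(AW),\mathrm{ind}(WA)\}$: the $W$-weighted core-EP inverse $A^{\mathrm{cEP},W}$ is the unique $Y\in\mathbb{C}^{m\times n}$ with $WAWY=(WA)^p[(WA)^p]^{\dagger}$ and $\mathcal{R}(Y)\subseteq\mathcal{R}((AW)^p)$; the $W$-weighted Drazin inverse $A^{D,W}$ is the unique $X\in\mathbb{C}^{m\times n}$ with $(AW)^p=(AW)^{p+1}XW$, $X=XWAWX$ and $AWX=XWA$. $P_{B}=BB^{\dagger}$ denotes the orthogonal projector onto $\mathcal{R}(B)$, and $P_{T,S}$ denotes the (oblique) projector onto $T$ along $S$, for complementary subspaces $T,S$. *)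

(* Defs.v *)
From mathcomp Require Export all_boot all_order all_algebra.
From mathcomp Require Export classical_sets reals.
From mathcomp Require Export complex.

Set Implicit Arguments.
Unset Strict Implicit.
Unset Printing Implicit Defensive.

Import Order.TTheory GRing.Theory Num.Theory.

Local Open Scope ring_scope.
Local Open Scope sesquilinear_scope.

(* Only [R[i]] with [R : realType], i.e. the complex numbers, is used in the
   end; the definitions make sense over any [numClosedFieldType].

   "The unique matrix X such that ..." is rendered by [xget 0 [set X | ...]]:
   an element of this set, or 0 in case it is empty. The sets below to which
   this is applied always have exactly one element. *)

Section GeneralizedInverses.
Variable C : numClosedFieldType.

Lemma ind_subproof n (B : 'M[C]_n) :
  exists j, \rank (B ^+ j) == \rank (B ^+ j.+1).
Proof.
suff /(_ (\rank (B ^+ 0)).+1) [//|] : forall d,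
    (exists j, \rank (B ^+ j) == \rank (B ^+ j.+1))
    \/ (\rank (B ^+ d) + d <= \rank (B ^+ 0))%N.
  by rewrite addnS => /(leq_ltn_trans (leq_addl _ _)); rewrite ltnn.
elim=> [|d [IHd|IHd]]; [by right; rewrite addn0 | by left | ].
have [eq_r|ne_r] := eqVneq (\rank (B ^+ d)) (\rank (B ^+ d.+1)).
  by left; exists d; apply/eqP.
right; apply: leq_trans IHd; rewrite addnS ltn_add2r ltn_neqAle eq_sym ne_r /=.
by rewrite exprS; apply: mxrankM_maxr.
Qed.

Definition ind n (B : 'M[C]_n) : nat := ex_minn (ind_subproof B).

(* [mxalgebra] represents a subspace by the row space of a matrix, so subspaces
   of column vectors are encoded through their transposes. *)
Definition colspace m n (B : 'M[C]_(m, n)) : 'M[C]_m := <<B^T>>%MS.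

Definition nullspace m n (B : 'M[C]_(m, n)) : 'M[C]_n := kermx B^T.

Lemma colspaceP m n (B : 'M[C]_(m, n)) (x : 'cV[C]_m) :
  reflect (exists y : 'cV[C]_n, x = B *m y) (x^T <= colspace B)%MS.
Proof.
rewrite genmxE; apply: (iffP submxP) => [[D eqD]|[y ->]].
  by exists D^T; rewrite -[x]trmxK eqD trmx_mul trmxK.
by exists y^T; rewrite trmx_mul.
Qed.

Lemma nullspaceP m n (B : 'M[C]_(m, n)) (x : 'cV[C]_n) :
  reflect (B *m x = 0) (x^T <= nullspace B)%MS.
Proof.
apply: (iffP sub_kermxP) => [|Bx0]; last by rewrite -trmx_mul Bx0 trmx0.
by rewrite -trmx_mul => /(congr1 trmx); rewrite trmxK trmx0.
Qed.

(* [proj_mx] acts on row vectors, whence the transpose. *)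
Definition projector n (T S : 'M[C]_n) : 'M[C]_n := (proj_mx T S)^T.

Lemma projector_id n (T S : 'M[C]_n) (x : 'cV[C]_n) :
  (T :&: S = 0)%MS -> (x^T <= T)%MS -> projector T S *m x = x.
Proof.
by move=> TS xT; apply: trmx_inj; rewrite trmx_mul trmxK proj_mx_id.
Qed.

Lemma projector_0 n (T S : 'M[C]_n) (x : 'cV[C]_n) :
  (T :&: S = 0)%MS -> (x^T <= S)%MS -> projector T S *m x = 0.
Proof.
by move=> TS xS; apply: trmx_inj; rewrite trmx_mul trmxK trmx0 proj_mx_0.
Qed.

Definition is_mpinv m n (B : 'M[C]_(m, n)) (X : 'M[C]_(n, m)) : Prop :=
  [/\ B *m X *m B = B,
      X *m B *m X = X,
      (B *m X)^t* = B *m X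
    & (X *m B)^t* = X *m B].

Definition mpinv m n (B : 'M[C]_(m, n)) : 'M[C]_(n, m) :=
  xget 0 [set X | is_mpinv B X].

Definition orthproj m n (B : 'M[C]_(m, n)) : 'M[C]_m := B *m mpinv B.

Definition wind m n (A : 'M[C]_(m, n)) (W : 'M[C]_(n, m)) : nat :=
  maxn (ind (A *m W)) (ind (W *m A)).

Definition is_wcoreEP m n (A : 'M[C]_(m, n)) (W : 'M[C]_(n, m))
    (Y : 'M[C]_(m, n)) : Prop :=
  let p := wind A W in
  W *m A *m W *m Y = (W *m A) ^+ p *m mpinv ((W *m A) ^+ p)
  /\ (colspace Y <= colspace ((A *m W) ^+ p))%MS.

Definition wcoreEP m n (A : 'M[C]_(m, n)) (W : 'M[C]_(n, m)) : 'M[C]_(m, n) :=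
  xget 0 [set Y | is_wcoreEP A W Y].

Definition is_wDrazin m n (A : 'M[C]_(m, n)) (W : 'M[C]_(n, m))
    (X : 'M[C]_(m, n)) : Prop :=
  let p := wind A W in
  [/\ (A *m W) ^+ p = (A *m W) ^+ p.+1 *m X *m W,
      X = X *m W *m A *m W *m X
    & A *m W *m X = X *m W *m A].

Definition wDrazin m n (A : 'M[C]_(m, n)) (W : 'M[C]_(n, m)) : 'M[C]_(m, n) :=
  xget 0 [set X | is_wDrazin A W X].

End GeneralizedInverses.

(* Main.v *)
Require Import Defs.
Import GRing.Theory Num.Theory.
Local Open Scope ring_scope.
Local Open Scope complex_scope.

(** Put B = W A and let D be the Drazin inverse of B.  Everything follows from
    two closed forms, in which p may be any exponent at least ind(B):
    - the W-weighted Drazin inverse is A D^2 ([wDrazinE]): if X satisfies its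
      three equations, then W X satisfies those of the Drazin inverse of B, so
      W X = D, and X = X W A W X = A (W X)^2;
    - the W-weighted core-EP inverse is A D^2 P_{B^p} ([wcoreEPE]): A D^2 is a
      left inverse of W A W on the range of (A W)^p, where the core-EP inverse
      takes its values, and W A W times the core-EP inverse is P_{B^p}.

    The powers B^p with p >= ind(B) share one range, hence one orthogonal
    projector ([orthproj_eq]), and (1) is the comparison of the two forms.  For
    (2), the oblique projector onto R(B^k) along N(B^k) is B D
    ([projector_drazin]), P_{B^k} fixes its range, and D B D = D, so the right
    hand side of (2) is A D^2 B D = A D^2.

    Since the weighted inverses are chosen by their defining properties, the
    existence of Moore-Penrose and Drazin inverses also has to be shown.  Both
    are built from one-sided solutions: of B = Z B^* B in the first case
    ([mpinv_exists]), and of B^k = Y B^(k+1) = B^(k+1) X in the second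
    ([drazin_exists]). *)

(** * Drazin inverses in a semiring *)

(** The exponent q need only be an upper bound of the index, so that one
    element d can be compared with the powers of index ind(B) and of index p
    alike. *)
Definition is_drazin {R : pzSemiRingType} (a : R) (q : nat) (d : R) : Prop :=
  [/\ a * d = d * a, d * a * d = d & a ^+ q.+1 * d = a ^+ q].

Lemma expr_stable_right {R : pzSemiRingType} {a x : R} {q : nat} (j : nat) :
  a ^+ q = a ^+ q.+1 * x -> a ^+ q = a ^+ (q + j) * x ^+ j.
Proof.
move=> eq_q; elim: j => [|j IHj]; first by rewrite addn0 expr0 mulr1.
by rewrite {1}IHj addnC exprD {1}eq_q !mulrA -exprD -mulrA -exprS -addSnnS addnC.
Qed.

Lemma expr_stable_left {R : pzSemiRingType} {a y : R} {q : nat} (j : nat) :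
  a ^+ q = y * a ^+ q.+1 -> a ^+ q = y ^+ j * a ^+ (q + j).
Proof.
move=> eq_q; elim: j => [|j IHj]; first by rewrite addn0 expr0 mul1r.
by rewrite {1}IHj exprD {1}eq_q -mulrA -exprD mulrA -exprSr addSnnS.
Qed.

(** Once a^q = a^(2q+1) x = y a^(2q+1), the element a^q x = y a^q can be
    written with a power of a on either side, which is why it commutes with
    a. *)
Lemma drazin_of_strongly_pi_regular {R : pzSemiRingType} {a x y : R} {q : nat} :
  a ^+ q = a ^+ q.+1 * x -> a ^+ q = y * a ^+ q.+1 ->
  exists d, is_drazin a q d.
Proof.
move=> /(expr_stable_right q.+1) + /(expr_stable_left q.+1).
move: (x ^+ _) (y ^+ _) => {}x {}y eqx eqy.
have eqd : a ^+ q * x = y * a ^+ q.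
  by rewrite {1}eqy -mulrA -eqx.
have ad : a * (a ^+ q * x) = a ^+ q.+1 * x by rewrite mulrA -exprS.
have da : (a ^+ q * x) * a = y * a ^+ q.+1 by rewrite eqd -mulrA -exprSr.
exists (a ^+ q * x); split.
- rewrite ad da.
  by rewrite [in LHS]exprSr {1}eqy -(mulrA y) -exprSr exprS -!mulrA -eqx -exprS.
- rewrite da -(mulrA y) (mulrA (a ^+ q.+1)) -exprD addSnnS.
  by rewrite -eqx eqd.
- by rewrite mulrA -exprD addSnnS -eqx.
Qed.

Lemma drazin_exponent {R : pzSemiRingType} {a d : R} {q r : nat} :
  (q <= r)%N -> is_drazin a q d -> is_drazin a r d.
Proof.
move=> /subnK <- [ad dad aqd]; split=> //.
by rewrite -addnS exprD -mulrA aqd -exprD.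
Qed.

Lemma drazin_left {R : pzSemiRingType} {a d : R} {q : nat} :
  is_drazin a q d -> d * a ^+ q.+1 = a ^+ q.
Proof. by case=> ad _ aqd; rewrite -[RHS]aqd; apply: commrX. Qed.

Lemma drazin_proj_expr {R : pzSemiRingType} {a d : R} {q : nat} :
  is_drazin a q d -> a * d * a ^+ q = a ^+ q.
Proof. by move=> dq; case: (dq) => -> _ _; rewrite -mulrA -exprS drazin_left. Qed.

(** The relation d = d a d can be iterated because a and d commute; it puts d
    on the left of any power of a. *)
Lemma drazin_expand {R : pzSemiRingType} {a d : R} {q : nat} (j : nat) :
  is_drazin a q d -> d = d ^+ j.+1 * a ^+ j.
Proof.
case=> ad dad _; elim: j => [|j IHj]; first by rewrite expr1 expr0 mulr1.
by rewrite exprS (exprSr a) mulrA -(mulrA d) -IHj -mulrA -ad mulrA.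
Qed.

Lemma drazin_unique {R : pzSemiRingType} {a d e : R} {q r : nat} :
  is_drazin a q d -> is_drazin a r e -> d = e.
Proof.
move=> /(drazin_exponent (leq_addr r q)) dq /(drazin_exponent (leq_addl q r)).
move: (q + r)%N dq => {}q dq eq_.
(* Both d and e are equal to e a d: the powers of a in the expansions of d and
   e can absorb e a and a d respectively. *)
transitivity (e * a * d).
  have d_comm : d ^+ q.+1 * a ^+ q = a ^+ q * d ^+ q.+1.
    by case: dq => ad _ _; apply/commrX/commr_sym/commrX.
  rewrite [in RHS](drazin_expand q dq) d_comm mulrA -(mulrA e) -exprS.
  by rewrite (drazin_left eq_) -d_comm -(drazin_expand q dq).
rewrite [in LHS](drazin_expand q eq_) -!mulrA (mulrA (a ^+ q)) -exprSr.
by case: (dq) => _ _ ->; rewrite -(drazin_expand q eq_).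
Qed.

(** The spectral projector a d lies in the left and right ideals of a^q: in
    terms of matrices, its range and kernel are those of a^q, because a d also
    fixes a^q ([drazin_proj_expr]). *)
Lemma drazin_proj {R : pzSemiRingType} {a d : R} {q : nat} :
  is_drazin a q d -> exists c, a * d = c * a ^+ q /\ a * d = a ^+ q * c.
Proof.
move=> dq; have [ad _ _] := dq; exists (a * d ^+ q.+1).
have cd : GRing.comm d a by rewrite /GRing.comm ad.
have eq1 : a * d = a * d ^+ q.+1 * a ^+ q.
  by rewrite {1}(drazin_expand q dq) mulrA.
split=> //; rewrite eq1; apply: commr_sym.
by apply: commrM; [apply/commr_sym/commrX | apply/commrX/commr_sym/commrX].
Qed.

(** * Moore-Penrose inverses and orthogonal projectors *)

Local Open Scope sesquilinear_scope.

Lemma trmxC_mul {C : numClosedFieldType} {m n p : nat}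
    (A : 'M[C]_(m, n)) (B : 'M[C]_(n, p)) :
  (A *m B)^t* = B^t* *m A^t*.
Proof. by rewrite trmx_mul map_mxM. Qed.

(** The diagonal entries of M^* M are the squared norms of the columns. *)
Lemma gram_eq0 {C : numClosedFieldType} {m n : nat} (M : 'M[C]_(m, n)) :
  M^t* *m M = 0 -> M = 0.
Proof.
move=> gram0; apply/matrixP=> i j; rewrite mxE.
have /eqP := congr1 (fun X : 'M[C]_n => X j j) gram0.
rewrite !mxE psumr_eq0 => [|l _]; last by rewrite !mxE mulrC mul_conjC_ge0.
by move=> /allP/(_ i (mem_index_enum _)); rewrite !mxE mulrC mul_conjC_eq0 => /eqP.
Qed.

(** B^* B K = 0 gives (B K)^* (B K) = 0, hence B K = 0: the two matrices have
    the same kernel, so the same row space. *)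
Lemma submx_gram {C : numClosedFieldType} {m n : nat} (B : 'M[C]_(m, n)) :
  (B <= B^t* *m B)%MS.
Proof.
rewrite submxE; apply/eqP/gram_eq0.
by rewrite trmxC_mul -mulmxA (mulmxA (B^t*)) mulmx_coker mulmx0.
Qed.

(** G = (B^* B)^- B^* for any inner inverse of B^* B: B = Z B^* B gives
    B G B = B, and makes B G = Z (B^* B) Z^* Hermitian. *)
Lemma least_squares_inverse_exists {C : numClosedFieldType} {m n : nat}
    (B : 'M[C]_(m, n)) :
  exists G : 'M[C]_(n, m), B *m G *m B = B /\ (B *m G)^t* = B *m G.
Proof.
have [S eqS] : exists S, S = B^t* *m B by eexists.
have /submxP [Z] := submx_gram B; rewrite -eqS => eqB.
have [V inner] : exists V, S *m V *m S = S by exists (pinvmx S); rewrite mulmxKpV.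
have S_herm : S^t* = S by rewrite eqS trmxC_mul trmxCK.
have eqBt : B^t* = S *m Z^t* by rewrite {1}eqB trmxC_mul S_herm.
exists (V *m B^t*).
have eqBG : B *m (V *m B^t*) = Z *m S *m Z^t*.
  by rewrite eqBt {1}eqB !mulmxA -!(mulmxA Z) inner.
split; last by rewrite eqBG !trmxC_mul trmxCK S_herm mulmxA.
by rewrite {1}eqB -!mulmxA -eqS (mulmxA S) inner -eqB.
Qed.

(** The product G' B G, where G makes B G an orthogonal projector and G' does
    the same for G' B; G' comes from a least-squares inverse of B^*. *)
Lemma mpinv_exists {C : numClosedFieldType} {m n : nat} (B : 'M[C]_(m, n)) :
  exists X, is_mpinv B X.
Proof.
have [G [BGB BG_herm]] := least_squares_inverse_exists B.
have [H [BHB BH_herm]] := least_squares_inverse_exists (B^t*).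
have BH'B : B *m H^t* *m B = B.
  by rewrite -[RHS]trmxCK -BHB !trmxC_mul trmxCK mulmxA.
have H'B_herm : (H^t* *m B)^t* = H^t* *m B.
  by rewrite trmxC_mul trmxCK -BH_herm trmxC_mul trmxCK.
exists (H^t* *m B *m G).
have eqBX : B *m (H^t* *m B *m G) = B *m G by rewrite !mulmxA BH'B.
have eqXB : H^t* *m B *m G *m B = H^t* *m B by rewrite -!mulmxA (mulmxA B) BGB.
split; rewrite ?eqBX ?eqXB //.
by rewrite -!mulmxA (mulmxA B) (mulmxA (B *m _)) BH'B.
Qed.

Lemma mpinvP {C : numClosedFieldType} {m n : nat} (B : 'M[C]_(m, n)) :
  is_mpinv B (mpinv B).
Proof. exact: (xgetPex 0 (mpinv_exists B)). Qed.

Lemma orthproj_id {C : numClosedFieldType} {m n p : nat} (B : 'M[C]_(m, n))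
    (E : 'M[C]_(m, p)) (Y : 'M[C]_(n, p)) : E = B *m Y -> orthproj B *m E = E.
Proof. by have [BXB _ _ _] := mpinvP B => ->; rewrite mulmxA BXB. Qed.

(** Two Hermitian idempotents P, Q with P Q = Q and Q P = P agree, because the
    adjoint of Q P = P is P Q = P. *)
Lemma orthproj_eq {C : numClosedFieldType} {m n p : nat} (B : 'M[C]_(m, n))
    (E : 'M[C]_(m, p)) (Y : 'M[C]_(n, p)) (Z : 'M[C]_(p, n)) :
  E = B *m Y -> B = E *m Z -> orthproj B = orthproj E.
Proof.
move=> eqE eqB.
have [_ _ B_herm _] := mpinvP B; have [_ _ E_herm _] := mpinvP E.
have BE : orthproj B *m orthproj E = orthproj E.
  by rewrite {2}/orthproj mulmxA (orthproj_id _ _ _ eqE).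
have EB : orthproj E *m orthproj B = orthproj B.
  by rewrite {2}/orthproj mulmxA (orthproj_id _ _ _ eqB).
by rewrite -BE -[LHS]B_herm -/(orthproj B) -{1}EB trmxC_mul B_herm E_herm.
Qed.

(** * Drazin inverses of matrices *)

Lemma row_stable {F : fieldType} {n : nat} (B : 'M[F]_n) (q : nat) :
  \rank (B ^+ q) = \rank (B ^+ q.+1) -> exists Y, B ^+ q = Y *m B ^+ q.+1.
Proof.
move=> eq_r; have sub : (B ^+ q.+1 <= B ^+ q)%MS.
  by rewrite exprS; apply: submxMl.
suff /submxP [Y eqY] : (B ^+ q <= B ^+ q.+1)%MS by exists Y.
by rewrite -(mxrank_leqif_sup sub) eq_r.
Qed.

Lemma trmx_exp {F : fieldType} {n : nat} (B : 'M[F]_n) (q : nat) :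
  (B ^+ q)^T = B^T ^+ q.
Proof.
elim: q => [|q IHq]; first by rewrite !expr0 trmx1.
by rewrite exprS exprSr -!mulmxE trmx_mul IHq.
Qed.

Lemma col_stable {F : fieldType} {n : nat} (B : 'M[F]_n) (q : nat) :
  \rank (B ^+ q) = \rank (B ^+ q.+1) -> exists X, B ^+ q = B ^+ q.+1 *m X.
Proof.
rewrite -mxrank_tr -[RHS]mxrank_tr !trmx_exp => /row_stable [Y eqY].
by exists Y^T; apply: trmx_inj; rewrite trmx_mul trmxK !trmx_exp.
Qed.

Lemma rank_ind {C : numClosedFieldType} {n : nat} (B : 'M[C]_n) :
  \rank (B ^+ ind B) = \rank (B ^+ (ind B).+1).
Proof. by rewrite /ind; case: ex_minnP => j /eqP. Qed.

Lemma drazin_exists {C : numClosedFieldType} {n : nat} (B : 'M[C]_n) :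
  exists D, is_drazin B (ind B) D.
Proof.
have [[Y eqY] [X eqX]] := (row_stable _ _ (rank_ind B), col_stable _ _ (rank_ind B)).
exact: drazin_of_strongly_pi_regular eqX eqY.
Qed.

(** B D fixes B^q y and factors as c B^q, so a vector x = B^q y killed by B^q
    satisfies x = B D x = c B^q x = 0. *)
Lemma colspace_cap_nullspace {C : numClosedFieldType} {n q : nat} (B D : 'M[C]_n) :
  is_drazin B q D -> (colspace (B ^+ q) :&: nullspace (B ^+ q) = 0)%MS.
Proof.
move=> Dq; have [c [BD_l _]] := drazin_proj Dq.
apply/eqP; rewrite -submx0; apply/row_subP => i; rewrite submx0 -trmx_eq0.
set x := (row i _)^T.
have /colspaceP [y eqx] : (x^T <= colspace (B ^+ q))%MS.
  by rewrite trmxK (submx_trans (row_sub _ _)) ?capmxSl.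
have /nullspaceP Bx0 : (x^T <= nullspace (B ^+ q))%MS.
  by rewrite trmxK (submx_trans (row_sub _ _)) ?capmxSr.
have BDx : B *m D *m x = x.
  by rewrite eqx mulmxA; congr (_ *m y); apply: drazin_proj_expr.
by rewrite -BDx [B *m D]BD_l -mulmxA Bx0 mulmx0.
Qed.

(** The identity splits as B D + (1 - B D), where B D takes its values in
    R(B^q) and 1 - B D in N(B^q). *)
Lemma projector_drazin {C : numClosedFieldType} {n q : nat} (B D : 'M[C]_n) :
  is_drazin B q D ->
  projector (colspace (B ^+ q)) (nullspace (B ^+ q)) = B * D.
Proof.
move=> Dq; have TS0 := colspace_cap_nullspace _ _ Dq.
have [c [_ BD_r]] := drazin_proj Dq; have [BD _ BqD] := Dq.
apply: trmx_inj; rewrite /projector trmxK.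
set P := proj_mx _ _; rewrite -[LHS]mul1mx -(subrK (B * D)^T 1%:M) mulmxDl.
rewrite (proj_mx_0 TS0) ?(proj_mx_id TS0) ?add0r //.
  by rewrite BD_r /colspace genmxE -mulmxE trmx_mul submxMl.
apply/sub_kermxP; rewrite -[1%:M]trmx1 -linearB -trmx_mul mulmxE.
by rewrite mulrBr mulr1 mulrA -exprSr BqD subrr trmx0.
Qed.

(** * Weighted inverses *)

Lemma mulmx_exp_shift {R : pzSemiRingType} {m n : nat}
    (A : 'M[R]_(m, n)) (W : 'M[R]_(n, m)) (j : nat) :
  A *m (W *m A) ^+ j = (A *m W) ^+ j *m A.
Proof.
elim: j => [|j IHj]; first by rewrite !expr0 mulmx1 mul1mx.
by rewrite !exprS -!mulmxE -!mulmxA IHj !mulmxA.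
Qed.

(** Moved across A and W, the powers of A W become powers of W A, which absorb
    a factor D when the exponent exceeds p.  The exponent p + 1 pays for one D
    only; the power needed for the second one comes from
    (A W)^p = (A W)^(p+1) Z, whence a p that bounds ind(A W) too. *)
Lemma wdrazin_left_inverse {C : numClosedFieldType} {m n : nat}
    (A : 'M[C]_(m, n)) (W : 'M[C]_(n, m)) (D : 'M[C]_n) :
  is_drazin (W *m A) (wind A W) D ->
  A *m D *m D *m W *m (A *m W) ^+ (wind A W).+1 = (A *m W) ^+ wind A W.
Proof.
set p := wind A W => Dp.
have [Z eqZ] : exists Z, (A *m W) ^+ p = (A *m W) ^+ p.+1 *m Z.
  have [X eqX] := col_stable _ _ (rank_ind (A *m W)).
  exists X; rewrite /p /wind -(subnK (leq_maxl (ind (A *m W)) (ind (W *m A)))).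
  by rewrite -addnS !exprD -!mulmxE -mulmxA -eqX.
have DB : D *m (W *m A) ^+ p.+1 = (W *m A) ^+ p := drazin_left Dp.
rewrite -(mulmxA _ W) mulmx_exp_shift !mulmxA -(mulmxA _ D ((W *m A) ^+ p.+1)) DB.
rewrite -mulmxA -mulmx_exp_shift {1}eqZ.
rewrite (mulmxA W) mulmx_exp_shift -(mulmxA A) (mulmxA D) (mulmxA D) DB.
by rewrite !mulmxA mulmx_exp_shift -(mulmxA _ A W) mulmxE -exprSr -mulmxE -eqZ.
Qed.

(** [wdrazin_left_inverse] with the factors in the order of the first
    equation of the weighted Drazin inverse; D commutes with the powers of
    W A. *)
Lemma wdrazin_right_inverse {C : numClosedFieldType} {m n : nat}
    (A : 'M[C]_(m, n)) (W : 'M[C]_(n, m)) (D : 'M[C]_n) :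
  is_drazin (W *m A) (wind A W) D ->
  (A *m W) ^+ (wind A W).+1 *m (A *m D *m D) *m W = (A *m W) ^+ wind A W.
Proof.
set p := wind A W => Dp; rewrite -(wdrazin_left_inverse _ _ _ Dp) -/p.
have DB : (W *m A) ^+ p.+1 *m (D *m D) = (D *m D) *m (W *m A) ^+ p.+1.
  have [BD _ _] := Dp.
  by apply/commr_sym/commrX/commr_sym; apply: commrM.
rewrite -(mulmxA _ W) mulmx_exp_shift -(mulmxA A) (mulmxA _ A) -mulmx_exp_shift.
by rewrite -(mulmxA A) DB !mulmxA.
Qed.

Lemma is_wDrazin_drazin {C : numClosedFieldType} {m n : nat}
    (A : 'M[C]_(m, n)) (W : 'M[C]_(n, m)) (D : 'M[C]_n) :
  is_drazin (W *m A) (wind A W) D -> is_wDrazin A W (A *m D *m D).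
Proof.
move=> Dp; have [BD DBD _] := Dp; move: BD DBD; rewrite -!mulmxE => BD DBD.
have XWA : A *m D *m D *m (W *m A) = A *m D.
  by rewrite -mulmxA -BD mulmxA -(mulmxA A D) -(mulmxA A) DBD.
have AWX : A *m W *m (A *m D *m D) = A *m D.
  by rewrite !mulmxA -(mulmxA A W) -(mulmxA A) BD -(mulmxA A) DBD.
split; first by rewrite (wdrazin_right_inverse _ _ _ Dp).
- rewrite -(mulmxA _ W A) XWA !mulmxA -(mulmxA _ W A) -[in RHS](mulmxA A D).
  by rewrite -[in RHS](mulmxA A) DBD.
- by rewrite AWX -(mulmxA _ W A) XWA.
Qed.

(** W X is the Drazin inverse of W A: its three equations are those of X
    multiplied by W on the left and, for the first one, by A on the right. *)
Lemma wDrazin_unique {C : numClosedFieldType} {m n : nat} (A : 'M[C]_(m, n))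
    (W : 'M[C]_(n, m)) (D : 'M[C]_n) (X : 'M[C]_(m, n)) :
  is_drazin (W *m A) (wind A W) D -> is_wDrazin A W X -> X = A *m D *m D.
Proof.
set p := wind A W => Dp [eq1 eq2 eq3].
have WX_drazin : is_drazin (W *m A) p.+1 (W *m X).
  split.
  - by rewrite -!mulmxE -!mulmxA (mulmxA A) eq3 !mulmxA.
  - by rewrite -!mulmxE [in RHS]eq2 !mulmxA.
  - have shift : (A *m W) ^+ p.+1 *m A *m (W *m X) = (A *m W) ^+ p *m A.
      by rewrite -mulmxA (mulmxA A) eq3 !mulmxA -eq1.
    rewrite -mulmxE [_ ^+ p.+2]exprS [RHS]exprS -!mulmxE -!(mulmxA W).
    by rewrite !mulmx_exp_shift shift.
have WX : W *m X = D := drazin_unique WX_drazin Dp.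
by rewrite {1}eq2 -(mulmxA _ W X) -eq3 WX -(mulmxA A) WX.
Qed.

Lemma wDrazinE {C : numClosedFieldType} {m n : nat} (A : 'M[C]_(m, n))
    (W : 'M[C]_(n, m)) (D : 'M[C]_n) :
  is_drazin (W *m A) (wind A W) D -> wDrazin A W = A *m D *m D.
Proof.
move=> Dp; apply: (wDrazin_unique _ _ _ _ Dp).
by apply: (xgetPex 0); exists (A *m D *m D); apply: is_wDrazin_drazin.
Qed.

(** Existence: W A W (A D^2) = B D, which fixes the range of P_{B^p}.
    Uniqueness: A D^2 W A W fixes the range of (A W)^p, where the solutions
    take their values. *)
Lemma wcoreEPE {C : numClosedFieldType} {m n : nat} (A : 'M[C]_(m, n))
    (W : 'M[C]_(n, m)) (D : 'M[C]_n) :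
  is_drazin (W *m A) (wind A W) D ->
  wcoreEP A W = A *m D *m D *m orthproj ((W *m A) ^+ wind A W).
Proof.
set p := wind A W => Dp; have [BD DBD _] := Dp.
have DBp : D *m D *m (W *m A) ^+ p = (W *m A) ^+ p *m (D *m D).
  by apply/commrX/commr_sym/commrM.
apply: xget_unique => [|Y [eqY subY]].
  split; rewrite -/p.
    have WX : W *m (A *m D *m D) = D by move: DBD; rewrite -BD -mulmxE !mulmxA.
    rewrite mulmxA -(mulmxA _ W) WX /orthproj mulmxA.
    by congr (_ *m _); apply: drazin_proj_expr.
  rewrite /colspace !genmxE /orthproj mulmxA -!(mulmxA A) DBp 2!(mulmxA A).
  by rewrite mulmx_exp_shift -!mulmxA trmx_mul submxMl.
have [Z eqZ] : exists Z, Y = (A *m W) ^+ p *m Z.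
  have /submxP [Z eqZ] : (Y^T <= ((A *m W) ^+ p)^T)%MS.
    by move: subY; rewrite /colspace !genmxE.
  by exists Z^T; apply: trmx_inj; rewrite trmx_mul trmxK.
rewrite /orthproj -eqY eqZ -{1}(wdrazin_left_inverse _ _ _ Dp) -/p exprS -mulmxE.
by rewrite !mulmxA.
Qed.

Theorem theorem4p1 (R : realType) (m n : nat)
    (A : 'M[R[i]]_(m, n)) (W : 'M[R[i]]_(n, m)) (k : nat)
    (hk : ind (W *m A) = k) :
  wcoreEP A W = wDrazin A W *m orthproj ((W *m A) ^+ k) /\
  wDrazin A W = wcoreEP A W *m
    projector (colspace ((W *m A) ^+ k)) (nullspace ((W *m A) ^+ k)).
Proof.
have [D] := drazin_exists (W *m A); rewrite hk => Dk.
have le_kp : (k <= wind A W)%N by rewrite -hk leq_maxr.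
have Dp := drazin_exponent le_kp Dk.
have eqP : orthproj ((W *m A) ^+ wind A W) = orthproj ((W *m A) ^+ k).
  set j := (wind A W - k)%N; have eq_p : wind A W = (k + j)%N by rewrite subnKC.
  apply: (orthproj_eq _ _ (D ^+ j) ((W *m A) ^+ j)); last first.
    by rewrite eq_p exprD.
  have [_ _ BkD] := Dk; rewrite eq_p.
  exact: (expr_stable_right j (esym BkD)).
rewrite (wDrazinE _ _ _ Dp) (wcoreEPE _ _ _ Dp) eqP; split=> //.
have [_ DBD _] := Dk; have [c [_ BD_r]] := drazin_proj Dk.
rewrite (projector_drazin _ _ Dk) -[RHS]mulmxA (orthproj_id _ _ c BD_r).
by rewrite -[RHS]mulmxA; congr (_ *m _); rewrite mulmxE mulrA.
Qed.
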